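(* For every pair of integers $m \ge 3$ and $n \in \{3,4,5,6\}$, we have $\chi'_{st}(C_m \,\square\, P_n) = 6$.
   Context: A star edge-coloring of a graph $G$ is a proper edge-coloring of $G$ in which there is no bichromatic path and no bichromatic cycle of length four (i.e., with four edges). The star chromatic index $\chi'_{st}(G)$ is the minimum number of colors in a star edge-coloring of $G$. $C_m$ denotes the cycle on $m$ vertices and $P_n$ the path on $n$ vertices. $G \,\square\, H$ denotes the Cartesian product: vertex set $V(G)\times V(H)$, with $(u,v)(u',v')$ an edge iff either $uu'\in E(G)$ and $v=v'$, or $u=u'$ and $vv'\in E(H)$. *)

(* Defs.v *)
From HB Require Import structures.
From mathcomp Require Import all_boot.

Set Implicit Arguments.
Unset Strict Implicit.
Unset Printing Implicit Defensive.

Record sgraph := SGraph {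
  vertex :> finType;
  adj : rel vertex;
  adj_sym : symmetric adj;
  adj_irrefl : irreflexive adj }.

Definition edges (G : sgraph) : {set {set G}} :=
  [set [set uv.1; uv.2] | uv in [pred uv : G * G | adj uv.1 uv.2]].

Definition edge (G : sgraph) := {e : {set G} | e \in edges G}.

Section StarEdgeColoring.
Variables (G : sgraph) (k : nat) (c : {ffun edge G -> 'I_k}).

Definition proper_edge_coloring : bool :=
  [forall e : edge G, forall f : edge G,
     (e != f) && (val e :&: val f != set0) ==> (c e != c f)].

(* The edges between consecutive vertices of s, without, resp. with, the
   closing edge from the last vertex of s to the first one. *)
Definition path_edges (s : seq G) : seq {set G} :=
  [seq [set uv.1; uv.2] | uv <- zip s (behead s)].

Definition cycle_edges (s : seq G) : seq {set G} :=
  [seq [set uv.1; uv.2] | uv <- zip s (rot 1 s)].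

Definition bichromatic (es : seq {set G}) : bool :=
  #|[set c e | e in [pred e : edge G | val e \in es]]| == 2.

(* Length counts edges: a path of length 4 has 5 distinct vertices, a cycle of
   length 4 has 4 of them. *)
Definition star_edge_coloring : bool :=
  [&& proper_edge_coloring,
      [forall s : 5.-tuple G,
         sorted (@adj G) s && uniq s ==> ~~ bichromatic (path_edges s)] &
      [forall s : 4.-tuple G,
         cycle (@adj G) s && uniq s ==> ~~ bichromatic (cycle_edges s)]].

End StarEdgeColoring.

Definition star_edge_colorable (G : sgraph) (k : nat) : bool :=
  [exists c : {ffun edge G -> 'I_k}, star_edge_coloring c].

Lemma edge_between (G : sgraph) (u v : G) :
  adj u v -> exists e : edge G, val e = [set u; v].
Proof.
move=> uv; have H : [set u; v] \in edges G by apply/imsetP; exists (u, v).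
by exists (Sub [set u; v] H); rewrite SubK.
Qed.

(* An injective coloring is never bichromatic on three distinct edges. *)
Lemma injective_not_bichromatic (G : sgraph) k (c : {ffun edge G -> 'I_k})
    (es : seq {set G}) (e1 e2 e3 : edge G) :
  injective c -> uniq [:: val e1; val e2; val e3] ->
  {subset [:: val e1; val e2; val e3] <= es} -> ~~ bichromatic c es.
Proof.
move=> c_inj uniq3 sub3; rewrite /bichromatic card_imset // neq_ltn.
apply/orP; right.
have uniqe : uniq [:: e1; e2; e3] by rewrite -(map_inj_uniq val_inj).
rewrite -[3]/(size [:: e1; e2; e3]) -(card_uniqP uniqe).
apply: subset_leq_card; apply/subsetP => e e_in; rewrite inE.
by apply: sub3; rewrite -[X in _ \in X]/(map val [:: e1; e2; e3]) map_f.
Qed.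

Lemma set2_neq (T : finType) (a b d e : T) :
  a != d -> a != e -> [set a; b] != [set d; e].
Proof.
move=> ad ae; apply/eqP => /setP /(_ a).
by rewrite !inE eqxx (negPf ad) (negPf ae).
Qed.

Lemma star_edge_colorable_card (G : sgraph) :
  exists k, star_edge_colorable G k.
Proof.
exists #|{: edge G}|; apply/existsP; exists [ffun e => enum_rank e].
set c := [ffun _ => _].
have c_inj : injective c by move=> e f; rewrite !ffunE => /enum_rank_inj.
apply/and3P; split.
- apply/forallP => e; apply/forallP => f; apply/implyP => /andP[ef _].
  by apply: contra ef => /eqP /c_inj ->.
- apply/forallP => -[[|x1 [|x2 [|x3 [|x4 [|x5 []]]]]] //= _].
  apply/implyP => /andP[/and5P[a12 a23 a34 _ _]].
  rewrite !inE !negb_or.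
  move=> /and5P[/and4P[n12 n13 n14 _] /and3P[n23 n24 _] /andP[n34 _] _ _].
  have [e1 E1] := edge_between a12; have [e2 E2] := edge_between a23.
  have [e3 E3] := edge_between a34.
  apply: (injective_not_bichromatic (e1 := e1) (e2 := e2) (e3 := e3)) => //.
    by rewrite /= !inE E1 E2 E3 !negb_or !set2_neq.
  by rewrite E1 E2 E3 => z; rewrite !inE => /or3P[]/eqP->; rewrite eqxx ?orbT.
- apply/forallP => -[[|x1 [|x2 [|x3 [|x4 []]]]] //= _].
  apply/implyP => /andP[/and5P[a12 a23 a34 _ _]].
  rewrite !inE !negb_or.
  move=> /and4P[/and3P[n12 n13 n14] /andP[n23 n24] n34 _].
  have [e1 E1] := edge_between a12; have [e2 E2] := edge_between a23.
  have [e3 E3] := edge_between a34.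
  apply: (injective_not_bichromatic (e1 := e1) (e2 := e2) (e3 := e3)) => //.
    by rewrite /= !inE E1 E2 E3 !negb_or !set2_neq.
  by rewrite E1 E2 E3 => z; rewrite !inE => /or3P[]/eqP->; rewrite eqxx ?orbT.
Qed.

Definition star_chromatic_index (G : sgraph) : nat :=
  ex_minn (star_edge_colorable_card G).

Section Cycle.
Variable m : nat.

(* The conjunct u != v only matters for the degenerate case m = 1. *)
Definition cycle_adj : rel 'I_m :=
  fun u v => (u != v) && ((v == u.+1 %% m :> nat) || (u == v.+1 %% m :> nat)).

Lemma cycle_adj_sym : symmetric cycle_adj.
Proof. by move=> u v; rewrite /cycle_adj eq_sym orbC. Qed.

Lemma cycle_adj_irrefl : irreflexive cycle_adj.
Proof. by move=> u; rewrite /cycle_adj eqxx. Qed.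

Definition cycle_graph : sgraph := SGraph cycle_adj_sym cycle_adj_irrefl.

End Cycle.

Section Path.
Variable n : nat.

Definition path_adj : rel 'I_n :=
  fun u v => (v == u.+1 :> nat) || (u == v.+1 :> nat).

Lemma path_adj_sym : symmetric path_adj.
Proof. by move=> u v; rewrite /path_adj orbC. Qed.

Lemma path_adj_irrefl : irreflexive path_adj.
Proof. by move=> u; rewrite /path_adj orbb; apply/negbTE; rewrite neq_ltn leqnn. Qed.

Definition path_graph : sgraph := SGraph path_adj_sym path_adj_irrefl.

End Path.

Section CartesianProduct.
Variables G H : sgraph.

Definition cart_adj : rel (G * H) :=
  fun x y => (adj x.1 y.1 && (x.2 == y.2)) || ((x.1 == y.1) && adj x.2 y.2).

Lemma cart_adj_sym : symmetric cart_adj.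
Proof.
move=> x y; rewrite /cart_adj (adj_sym x.1) (adj_sym x.2).
by rewrite (eq_sym x.1) (eq_sym x.2).
Qed.

Lemma cart_adj_irrefl : irreflexive cart_adj.
Proof. by move=> x; rewrite /cart_adj !adj_irrefl andbF. Qed.

Definition cartesian_product : sgraph := SGraph cart_adj_sym cart_adj_irrefl.

End CartesianProduct.

(* Main.v *)
(** A star edge-coloring is the same thing as a proper coloring without an
    alternating non-backtracking walk of length four: such a walk that is neither
    a path nor a 4-cycle contains a triangle, on which a proper coloring cannot
    alternate. In this form, star edge-colorings pull back along locally injective
    homomorphisms.

    Lower bound: reduction modulo m is a locally injective homomorphism from the
    5 x 3 grid to the product of C_m and P_n, and a backtracking search shows that
    this grid has no star edge-coloring with 5 colors.

    Upper bound: it suffices to color the product of C_m and P_6. A walk of length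
    four stays within two columns of its middle vertex, so a cyclic sequence of
    colored columns gives a star edge-coloring as soon as each of its windows of
    five consecutive columns does. A block of 3 columns can be repeated, and blocks
    of 7 or 8 columns inserted into the repetition, which yields every m >= 3 except
    4 and 5; these have colorings of their own. *)

Require Import Defs.
From mathcomp Require Import all_boot.

Set Implicit Arguments.
Unset Strict Implicit.
Unset Printing Implicit Defensive.

(** * Star edge-colorings in terms of walks of length four *)

Definition star_walk_coloring (G : sgraph) (k : nat) (col : G -> G -> nat) :=
  [/\ forall u v, adj u v -> col u v = col v u,
      forall u v, adj u v -> col u v < k,
      forall u v w, adj u v -> adj v w -> u != w -> col u v != col v w
    & forall a b c d e, adj a b -> adj b c -> adj c d -> adj d e ->
        a != c -> b != d -> c != e ->
        ~~ ((col a b == col c d) && (col b c == col d e))].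

Lemma adj_neq (G : sgraph) (u v : G) : adj u v -> u != v.
Proof. by apply: contraTneq => ->; rewrite adj_irrefl. Qed.

(** If [a != c], then [a], [b], [c] are three distinct elements; if [b != d], so are [b], [c],
    [d]. *)
Lemma card_set4_eq2 (T : finType) (a b c d : T) :
  a != b -> b != c -> c != d ->
  (#|[set a; b; c; d]| == 2) = (a == c) && (b == d).
Proof.
move=> ab bc cd; apply/idP/andP => [/eqP card2 | [/eqP-> /eqP->]]; last first.
  by rewrite -setUA setUid cards2 cd.
have sub2 x y z : x != y -> x != z -> y != z ->
    [set x; y; z] \subset [set a; b; c; d] -> False.
  move=> xy xz yz /subset_leq_card; rewrite card2.
  by rewrite setUC cardsU1 cards2 xy !inE negb_or ![z == _]eq_sym xz yz.
split; apply: contraT => neq.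
  case: (sub2 a b c) => //; apply/subsetP => x; rewrite !inE -!orbA.
  by case/or3P=> ->; rewrite ?orbT.
case: (sub2 b c d) => //; apply/subsetP => x; rewrite !inE -!orbA.
by case/or3P=> ->; rewrite ?orbT.
Qed.

Lemma bichromatic4 (G : sgraph) k (c : {ffun edge G -> 'I_k})
    (e1 e2 e3 e4 : edge G) :
  c e1 != c e2 -> c e2 != c e3 -> c e3 != c e4 ->
  bichromatic c [:: val e1; val e2; val e3; val e4] =
  (c e1 == c e3) && (c e2 == c e4).
Proof.
move=> n12 n23 n34; rewrite /bichromatic -card_set4_eq2 //.
congr (#|pred_of_set _| == 2); apply/setP => x; rewrite !inE -!orbA.
apply/imsetP/idP => [[e] | ].
  by rewrite !inE !(inj_eq val_inj) => /or4P[]/eqP-> ->; rewrite eqxx ?orbT.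
by case/or4P=> /eqP->; [exists e1|exists e2|exists e3|exists e4];
  rewrite // !inE eqxx ?orbT.
Qed.

Lemma edge_ex (G : sgraph) (e : edge G) :
  exists u v, adj u v /\ val e = [set u; v].
Proof. by case/imsetP: (valP e) => -[u v] uv ->; exists u, v. Qed.

Lemma edge_at (G : sgraph) (e : edge G) v :
  v \in val e -> exists u, adj u v /\ val e = [set u; v].
Proof.
have [x [y [xy ->]]] := edge_ex e; rewrite !inE => /orP[]/eqP->.
  by exists y; rewrite adj_sym setUC.
by exists x.
Qed.

Lemma star_edge_colorableP (G : sgraph) k :
  star_edge_colorable G k <-> exists col, @star_walk_coloring G k col.
Proof.
split=> [/existsP[c /and3P[/'forall_forallP proper /forallP star4 /forallP cyc4]]
        | [col [colC col_lt proper star]]].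
  (* Pairs that are not edges get the default 0; every condition on [col] is restricted to adjacent
     pairs. *)
  pose col u v := oapp (fun e => nat_of_ord (c e)) 0 (insub [set u; v]).
  have colE u v (e : edge G) : val e = [set u; v] -> col u v = c e.
    by rewrite /col => <-; rewrite valK.
  have colC u v : col u v = col v u by rewrite /col setUC.
  have prop u v w (e f : edge G) : val e = [set u; v] -> val f = [set v; w] ->
      adj u v -> u != w -> c e != c f.
    move=> Ee Ef uv uw; apply: (implyP (proper e f)).
    rewrite -(inj_eq val_inj) Ee Ef; apply/andP; split.
      by rewrite set2_neq // adj_neq.
    by apply/set0Pn; exists v; rewrite !inE eqxx orbT.
  exists col; split=> //.
  - by move=> u v /edge_between[e /colE->].
  - move=> u v w uv vw uw; have [e Ee] := edge_between uv.
    have [f Ef] := edge_between vw; rewrite (colE _ _ _ Ee) (colE _ _ _ Ef).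
    exact: prop Ee Ef _ _.
  move=> x1 x2 x3 x4 x5 a12 a23 a34 a45 n13 n24 n35.
  have [e1 E1] := edge_between a12; have [e2 E2] := edge_between a23.
  have [e3 E3] := edge_between a34; have [e4 E4] := edge_between a45.
  rewrite (colE _ _ _ E1) (colE _ _ _ E2) (colE _ _ _ E3) (colE _ _ _ E4).
  have c12 := prop _ _ _ _ _ E1 E2 a12 n13.
  have c23 := prop _ _ _ _ _ E2 E3 a23 n24.
  have c34 := prop _ _ _ _ _ E3 E4 a34 n35.
  rewrite !(inj_eq val_inj) -bichromatic4 // E1 E2 E3 E4.
  have [n12 n23] := (adj_neq a12, adj_neq a23).
  have [n34 n45] := (adj_neq a34, adj_neq a45).
  (* If [x1 = x4], the edges [e1] and [e3] meet at this vertex and so differ in color; likewise [e2]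
     and [e4] if [x2 = x5]. If [x1 = x5], the walk is a 4-cycle; otherwise it is a path. *)
  have [x14|n14] := eqVneq x1 x4.
    rewrite -E1 -E2 -E3 -E4 bichromatic4 // negb_and.
    rewrite eq_sym (prop x3 x4 x2) //; last by rewrite eq_sym.
    by rewrite E1 x14.
  have [x25|n25] := eqVneq x2 x5.
    rewrite -E1 -E2 -E3 -E4 bichromatic4 // negb_and orbC.
    rewrite eq_sym (prop x4 x5 x3) //; last by rewrite eq_sym.
    by rewrite E2 x25.
  have [x15|n15] := eqVneq x1 x5.
    have /implyP := cyc4 [tuple x1; x2; x3; x4].
    rewrite /= !inE !negb_or n12 n13 n14 n23 n24 n34 a12 a23 a34 {1}x15 a45 /=.
    by rewrite /cycle_edges /= -x15; apply.
  have /implyP := star4 [tuple x1; x2; x3; x4; x5].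
  rewrite /= !inE !negb_or n12 n13 n14 n15 n23 n24 n25 n34 n35 n45.
  by rewrite a12 a23 a34 a45; apply.
(* By symmetry of [col], the color of an edge does not depend on the order of its ends. *)
have /fin_all_exists[c cE] (e : edge G) :
    exists i : 'I_k, forall u v, val e = [set u; v] -> i = col u v :> nat.
  have [u [v [uv Ee]]] := edge_ex e; exists (Ordinal (col_lt _ _ uv)).
  move=> u' v'; rewrite Ee /= => /setP E; move: (E u) (E v) (uv).
  rewrite !inE !eqxx !orbT => /esym/orP[]/eqP-> /esym/orP[]/eqP->;
    by rewrite ?adj_irrefl // => /colC.
have colE (e : edge G) u v : val e = [set u; v] -> (finfun c) e = col u v :> nat.
  by rewrite ffunE; apply: cE.
apply/existsP; exists (finfun c); apply/and3P; split.
- apply/'forall_forallP => e f; apply/implyP => /andP[ef /set0Pn[v]].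
  rewrite inE => /andP[/edge_at[u [uv Ee]] /edge_at[w [wv Ef]]].
  rewrite setUC in Ef; rewrite -(inj_eq (@ord_inj k)) (colE _ _ _ Ee) (colE _ _ _ Ef).
  apply: proper; rewrite // 1?adj_sym //.
  by apply: contraNneq ef => uw; rewrite -val_eqE /= Ee Ef uw setUC.
- apply/forallP => -[[|x1 [|x2 [|x3 [|x4 [|x5 []]]]]] //= _].
  apply/implyP => /andP[/and5P[a12 a23 a34 a45 _]].
  rewrite !inE !negb_or.
  move=> /and5P[/and4P[_ n13 _ _] /and3P[_ n24 _] /andP[_ n35] _ _].
  have [e1 E1] := edge_between a12; have [e2 E2] := edge_between a23.
  have [e3 E3] := edge_between a34; have [e4 E4] := edge_between a45.
  rewrite /path_edges /= -E1 -E2 -E3 -E4 bichromatic4 -?(inj_eq (@ord_inj k))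
    ?(colE _ _ _ E1) ?(colE _ _ _ E2) ?(colE _ _ _ E3) ?(colE _ _ _ E4);
    by [apply: star | apply: proper].
- apply/forallP => -[[|x1 [|x2 [|x3 [|x4 []]]]] //= _].
  apply/implyP => /andP[/and5P[a12 a23 a34 a41 _]].
  rewrite !inE !negb_or.
  move=> /and4P[/and3P[_ n13 _] /andP[_ n24] _ _].
  have [e1 E1] := edge_between a12; have [e2 E2] := edge_between a23.
  have [e3 E3] := edge_between a34; have [e4 E4] := edge_between a41.
  rewrite /cycle_edges /= -E1 -E2 -E3 -E4 bichromatic4 -?(inj_eq (@ord_inj k))
    ?(colE _ _ _ E1) ?(colE _ _ _ E2) ?(colE _ _ _ E3) ?(colE _ _ _ E4);
    by [apply: star; rewrite // eq_sym | apply: proper; rewrite // eq_sym].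
Qed.

(** Local injectivity keeps the images of non-backtracking walks non-backtracking, even when they
    close up. *)
Lemma star_edge_colorable_hom (G H : sgraph) (f : G -> H) k :
  (forall u v, adj u v -> adj (f u) (f v)) ->
  (forall u v w, adj u v -> adj v w -> u != w -> f u != f w) ->
  star_edge_colorable H k -> star_edge_colorable G k.
Proof.
move=> f_adj f_inj /star_edge_colorableP[col [colC col_lt proper star]].
apply/star_edge_colorableP; exists (fun u v => col (f u) (f v)); split.
- by move=> u v /f_adj/colC.
- by move=> u v /f_adj/col_lt.
- by move=> u v w uv vw uw; apply: proper; [exact: f_adj.. | exact: f_inj uv vw uw].
move=> a b c d e ab bc cd de ac bd ce.
apply: star; try exact: f_adj.
- exact: f_inj ab bc ac.
- exact: f_inj bc cd bd.
- exact: f_inj cd de ce.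
Qed.

Lemma star_edge_colorable_leq (G : sgraph) k l :
  k <= l -> star_edge_colorable G k -> star_edge_colorable G l.
Proof.
move=> kl /star_edge_colorableP[col [colC col_lt proper star]].
apply/star_edge_colorableP; exists col; split=> // u v /col_lt uv.
exact: leq_trans uv kl.
Qed.

Lemma star_chromatic_index_eq (G : sgraph) k :
  star_edge_colorable G k.+1 -> ~~ star_edge_colorable G k ->
  star_chromatic_index G = k.+1.
Proof.
move=> colS ncol; rewrite /star_chromatic_index; case: ex_minnP => l coll lmin.
apply/eqP; rewrite eqn_leq lmin //= ltnNge.
by apply: contra ncol => lk; apply: star_edge_colorable_leq coll.
Qed.

(** * Exhaustive search on the 5 x 3 grid with 5 colors *)

Definition satisfies (s : seq nat) (q : nat * nat * nat * nat) : bool :=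
  let: (a, b, c, d) := q in
  ~~ ((nth 0 s a == nth 0 s b) && (nth 0 s c == nth 0 s d)).

(* The constraints of the i-th list involve no variable beyond the i-th one to be
   assigned. The conditional, unlike the strict [&&], lets the virtual machine
   prune the search. *)
Fixpoint extendable (k : nat) (css : seq (seq (nat * nat * nat * nat)))
    (s : seq nat) : bool :=
  if css is cs :: css' then
    has (fun x => let s' := rcons s x in
           if all (satisfies s') cs then extendable k css' s' else false)
        (iota 0 k)
  else true.

(** The values of [w] form a branch of the search tree that is never pruned. *)
Lemma extendable_mkseq k (w : nat -> nat) css n :
  (forall i, i < n + size css -> w i < k) ->
  (forall j, j < size css ->
     all (satisfies (mkseq w (n + j).+1)) (nth [::] css j)) ->
  extendable k css (mkseq w n).
Proof.
elim: css n => //= cs css IH n w_lt sat; apply/hasP; exists (w n).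
  by rewrite mem_iota /= add0n w_lt // addnS ltnS leq_addr.
rewrite -mkseqS -{1}[n]addn0 (sat 0) //; apply: IH => [i | j j_lt].
  by rewrite addSnnS; apply: w_lt.
by have := sat j.+1 j_lt; rewrite addnS.
Qed.

(* Vertex (x, y) of the grid is encoded as 3 * x + y. *)
Definition grid53_vertex (u : nat) :
    cartesian_product (path_graph 5) (path_graph 3) :=
  (inord (u %/ 3), inord (u %% 3)).

(* Ordered from the center outwards, which keeps the search tree small; the first
   four edges are those at the central vertex 7. *)
Definition grid53_edges : seq (nat * nat) :=
  [:: (4, 7); (6, 7); (7, 8); (7, 10); (1, 4); (3, 4); (4, 5); (3, 6); (5, 8);
      (6, 9); (8, 11); (9, 10); (10, 11); (10, 13); (0, 3); (0, 1); (1, 2);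
      (2, 5); (9, 12); (11, 14); (12, 13); (13, 14)].

Definition grid53_adj (u v : nat) : bool :=
  ((u, v) \in grid53_edges) || ((v, u) \in grid53_edges).

Definition edge_index (u v : nat) : nat :=
  find (fun e => (e == (u, v)) || (e == (v, u))) grid53_edges.

Lemma grid53_vertex_inj : {in gtn 15 &, injective grid53_vertex}.
Proof.
move=> u v; rewrite !inE => ult vlt [/(congr1 val)/= uv1 /(congr1 val)/= uv2].
by rewrite (divn_eq u 3) (divn_eq v 3); move: uv1 uv2;
  rewrite !inordK ?ltn_mod ?ltn_divLR // => -> ->.
Qed.

Lemma grid53_vertex_adj u v :
  grid53_adj u v ->
  [/\ u < 15, v < 15 & adj (grid53_vertex u) (grid53_vertex v)].
Proof.
have H : all (fun e => [&& e.1 < 15, e.2 < 15 &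
    (e.2 == e.1.+1) && (e.1 %/ 3 == e.2 %/ 3) && (e.2 %% 3 == (e.1 %% 3).+1) ||
    (e.2 %/ 3 == (e.1 %/ 3).+1) && (e.1 %% 3 == e.2 %% 3)]) grid53_edges by [].
have {}H x y : (x, y) \in grid53_edges ->
    [/\ x < 15, y < 15 & adj (grid53_vertex x) (grid53_vertex y)].
  move/(allP H) => /= /and3P[xlt ylt xy]; split=> //.
  rewrite /adj /= /cart_adj /= /path_adj -!(inj_eq val_inj) /=.
  rewrite !inordK ?ltn_mod ?ltn_divLR //.
  by case/orP: xy => [/andP[/andP[_ ->]->]|/andP[->->]]; rewrite ?orbT.
case/orP => [/H //|/H[vlt ult]]; rewrite adj_sym; split=> //.
Qed.

Definition grid53_walks (n : nat) : seq (seq nat) :=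
  iter n
    (fun ws => [seq v :: w | w <- ws,
                  v <- [seq v <- iota 0 15 | grid53_adj v (head 0 w)]])
    [seq [:: v] | v <- iota 0 15].

Definition is_walk3 (w : seq nat) : bool :=
  if w is [:: a; b; c] then
    [&& grid53_adj a b, grid53_adj b c & a != c] else false.

Definition is_walk5 (w : seq nat) : bool :=
  if w is [:: a; b; c; d; e] then
    [&& is_walk3 [:: a; b; c], is_walk3 [:: b; c; d] & is_walk3 [:: c; d; e]]
  else false.

(** Properness is encoded by repeating one equality, so that both kinds of constraint share one
    format. The default is never reached, since the walks are filtered by shape. *)
Definition quad_of_walk (w : seq nat) : nat * nat * nat * nat :=
  match w with
  | [:: a; b; c] =>
      (edge_index a b, edge_index b c, edge_index a b, edge_index b c)
  | [:: a; b; c; d; e] =>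
      (edge_index a b, edge_index c d, edge_index b c, edge_index d e)
  | _ => (0, 0, 0, 0)
  end.

Definition grid53_quads : seq (nat * nat * nat * nat) :=
  [seq quad_of_walk w |
    w <- filter is_walk3 (grid53_walks 2) ++ filter is_walk5 (grid53_walks 4)].

Definition quad_max (q : nat * nat * nat * nat) : nat :=
  let: (a, b, c, d) := q in maxn (maxn a b) (maxn c d).

(** A constraint is filed under its largest edge index, hence tested as soon as all its colors are
    known; the grid has 22 edges. *)
Definition grid53_constraints : seq (seq (nat * nat * nat * nat)) :=
  [seq [seq q <- grid53_quads | quad_max q == t] | t <- iota 0 22].

(** The four dropped lists concern only the edges at the central vertex, whose colors are fixed. *)
Lemma grid53_not_extendable :
  ~~ extendable 5 (drop 4 grid53_constraints) [:: 0; 1; 2; 3].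
Proof. by vm_compute. Qed.

Lemma satisfies_mkseq (w : nat -> nat) a b c d xa xb xc xd :
  w a = xa -> w b = xb -> w c = xc -> w d = xd ->
  ~~ ((xa == xb) && (xc == xd)) ->
  satisfies (mkseq w (quad_max (a, b, c, d)).+1) (a, b, c, d).
Proof.
move=> <- <- <- <-.
by rewrite /satisfies /= !nth_mkseq // ltnS !leq_max leqnn ?orbT.
Qed.

(** At most one number below [k] is absent from [s]; [index] sends it to [size s], apart from the
    positions of the others. *)
Lemma index_inj_lt (s : seq nat) k :
  uniq s -> all (gtn k) s -> k <= (size s).+1 ->
  {in gtn k &, injective (index^~ s)}.
Proof.
move=> s_uniq /allP s_lt sz x y xk yk /= exy; have [xs|xs] := boolP (x \in s).
  have ys : y \in s by rewrite -index_mem -exy index_mem.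
  by rewrite -(nth_index 0 xs) exy nth_index.
have [//|neq] := eqVneq x y.
have ys : y \notin s by rewrite -index_mem -exy index_mem.
have : size [:: x, y & s] <= size (iota 0 k).
  apply: uniq_leq_size => [|z]; first by rewrite /= inE negb_or neq xs ys.
  by rewrite mem_iota !inE => /or3P[/eqP->|/eqP->|/s_lt].
by rewrite size_iota /= => /leq_trans/(_ sz); rewrite ltnn.
Qed.

Lemma star_walk_coloring_recolor (G : sgraph) k (f : nat -> nat)
    (col : G -> G -> nat) :
  {in gtn k &, injective f} -> (forall x, x < k -> f x < k) ->
  star_walk_coloring k col -> star_walk_coloring k (fun u v => f (col u v)).
Proof.
move=> f_inj f_lt [colC col_lt proper star].
have fE u v x y : adj u v -> adj x y ->
    (f (col u v) == f (col x y)) = (col u v == col x y).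
  by move=> uv xy; rewrite (inj_in_eq f_inj) // inE col_lt.
split=> [u v /colC-> // | u v /col_lt/f_lt // | u v w uv vw uw |
  a b c d e ab bc cd de *].
  by rewrite fE // proper.
by rewrite !fE // star.
Qed.

(** Such a coloring, read off along [grid53_edges], would be a successful branch of the search. *)
Lemma grid53_normalized_coloring
    (col : cartesian_product (path_graph 5) (path_graph 3) -> _ -> nat) :
  star_walk_coloring 5 col ->
  [seq col (grid53_vertex 7) (grid53_vertex u) | u <- [:: 4; 6; 8; 10]] <>
  [:: 0; 1; 2; 3].
Proof.
move=> [colC col_lt proper star] col7; apply: (negP grid53_not_extendable).
pose w i := let e := nth (0, 1) grid53_edges i in
  col (grid53_vertex e.1) (grid53_vertex e.2).
have adjV u v : grid53_adj u v -> adj (grid53_vertex u) (grid53_vertex v).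
  by case/grid53_vertex_adj.
have wE u v : grid53_adj u v ->
    w (edge_index u v) = col (grid53_vertex u) (grid53_vertex v).
  move=> uv; have uvC := colC _ _ (adjV _ _ uv).
  have : has (fun e => (e == (u, v)) || (e == (v, u))) grid53_edges.
    by case/orP: uv => uv; apply/hasP; eexists; eauto; rewrite eqxx ?orbT.
  by move/(nth_find (0, 1)); rewrite /w => /orP[]/eqP->.
have neq u v x : is_walk3 [:: u; v; x] -> grid53_vertex u != grid53_vertex x.
  case/and3P=> /grid53_vertex_adj[u15 _ _] /grid53_vertex_adj[_ x15 _].
  by apply: contra_neq => /grid53_vertex_inj->.
have -> : [:: 0; 1; 2; 3] = mkseq w 4.
  by rewrite -col7 /= -!wE.
have sz : size (drop 4 grid53_constraints) = 18.
  by rewrite size_drop size_map size_iota.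
apply: extendable_mkseq; rewrite sz; first (move=> i i22).
  have /(mem_nth (0, 1)) ei : i < size grid53_edges by [].
  by apply/col_lt/adjV; rewrite /grid53_adj -surjective_pairing ei.
move=> j j18; have j22 : 4 + j < 22 by rewrite -[22]/(4 + 18) ltn_add2l.
rewrite nth_drop (nth_map 0) ?size_iota // nth_iota // add0n.
apply/allP => q; rewrite mem_filter => /andP[/eqP<- /mapP[p]].
rewrite mem_cat => /orP[]; rewrite mem_filter => /andP[pw _] ->.
  case: p pw => [|a [|b [|c []]]] // w3; have n13 := neq _ _ _ w3.
  case/and3P: w3 => ab bc _; have := satisfies_mkseq (wE _ _ ab) (wE _ _ bc).
  move/(_ _ _ _ _ (wE _ _ ab) (wE _ _ bc)); apply; rewrite andbb.
  by apply: proper; rewrite ?adjV.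
case: p pw => [|a [|b [|c [|d [|e []]]]]] // /and3P[w1 w2 w3].
have [n13 n24 n35] := And3 (neq _ _ _ w1) (neq _ _ _ w2) (neq _ _ _ w3).
case/and3P: w1 => ab bc _; case/and3P: w3 => cd de _.
apply: (satisfies_mkseq (wE _ _ ab) (wE _ _ cd) (wE _ _ bc) (wE _ _ de)).
by apply: star; rewrite ?adjV.
Qed.

(* Recoloring by the position in the list of the colors at the central vertex
   normalizes these colors to 0, 1, 2, 3. *)
Lemma grid53_not_star_edge_colorable :
  ~~ star_edge_colorable (cartesian_product (path_graph 5) (path_graph 3)) 5.
Proof.
apply/negP => /star_edge_colorableP[col colP].
have [colC col_lt proper star] := colP.
pose V := grid53_vertex.
pose s := [seq col (V 7) (V u) | u <- [:: 4; 6; 8; 10]].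
have adj7 u : u \in [:: 4; 6; 8; 10] -> adj (V 7) (V u).
  move=> u7; have [] := @grid53_vertex_adj 7 u; last by [].
  by move: u7; rewrite !inE => /or4P[]/eqP->.
have lt15 : {subset [:: 4; 6; 8; 10] <= gtn 15} by apply/allP.
have s_uniq : uniq s.
  rewrite map_inj_in_uniq // => u v u7 v7; apply: contra_eq => uv.
  rewrite colC ?adj7 //; apply: proper; rewrite ?adj7 // 1?adj_sym ?adj7 //.
  by apply: contra_neq uv => /grid53_vertex_inj; apply; apply: lt15.
have f_inj : {in gtn 5 &, injective (index^~ s)}.
  apply: index_inj_lt => //; apply/allP => x /mapP[u u7 ->].
  by rewrite /= col_lt ?adj7.
have f_lt x : x < 5 -> index x s < 5 by move=> _; rewrite ltnS; apply: index_size.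
apply: (grid53_normalized_coloring (star_walk_coloring_recolor f_inj f_lt colP)).
rewrite (map_comp (index^~ s)) -/V -/s.
apply: (@eq_from_nth _ 0) => // i i4; rewrite (nth_map 0) // index_uniq //.
by case: i i4 => [|[|[|[|]]]].
Qed.

(** * A table of columns and its finite verification *)

(* A column consists of the colors of the 6 edges leading to the next column,
   followed by the colors of the 5 vertical edges, both from bottom to top. The
   columns 0-2, 3-9, 10-17, 18-21 and 22-26 form blocks of lengths 3, 7, 8, 4
   and 5, found by computer search; only the first three can be combined. *)
Definition column_table : seq (seq nat) :=
  [::
      [:: 0; 1; 2; 0; 1; 2; 3; 4; 5; 3; 4];
      [:: 1; 2; 0; 1; 2; 0; 5; 3; 4; 5; 3];
      [:: 2; 0; 1; 2; 0; 1; 4; 5; 3; 4; 5];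
      [:: 0; 1; 2; 0; 1; 2; 3; 4; 5; 3; 4];
      [:: 2; 2; 0; 1; 2; 4; 5; 3; 4; 5; 3];
      [:: 1; 0; 5; 2; 0; 3; 4; 1; 3; 4; 5];
      [:: 2; 3; 1; 0; 4; 2; 5; 4; 3; 1; 5];
      [:: 4; 1; 2; 5; 1; 0; 5; 0; 4; 3; 5];
      [:: 3; 2; 0; 1; 2; 2; 5; 3; 4; 0; 3];
      [:: 2; 0; 1; 2; 0; 1; 4; 5; 3; 4; 5];
      [:: 0; 3; 2; 0; 1; 2; 1; 4; 5; 3; 4];
      [:: 3; 2; 4; 4; 2; 0; 5; 0; 1; 5; 3];
      [:: 2; 4; 0; 2; 1; 4; 1; 5; 3; 0; 5];
      [:: 0; 0; 2; 1; 0; 0; 3; 1; 5; 4; 3];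
      [:: 2; 2; 1; 0; 4; 1; 5; 4; 3; 2; 5];
      [:: 4; 1; 4; 4; 1; 5; 3; 0; 5; 3; 2];
      [:: 1; 2; 0; 1; 5; 0; 5; 3; 2; 0; 3];
      [:: 2; 0; 1; 2; 0; 1; 4; 5; 3; 4; 2];
      [:: 0; 1; 2; 1; 2; 1; 3; 0; 5; 4; 3];
      [:: 1; 5; 4; 3; 0; 5; 4; 3; 0; 5; 4];
      [:: 0; 2; 1; 2; 1; 2; 3; 0; 5; 4; 3];
      [:: 2; 5; 4; 3; 0; 5; 4; 3; 0; 5; 4];
      [:: 0; 0; 2; 5; 0; 1; 2; 5; 3; 1; 4];
      [:: 1; 5; 0; 2; 5; 5; 3; 4; 1; 4; 3];
      [:: 2; 3; 2; 4; 1; 4; 4; 1; 3; 0; 2];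
      [:: 3; 2; 1; 1; 2; 3; 0; 4; 5; 3; 0];
      [:: 4; 1; 4; 2; 3; 2; 5; 3; 0; 4; 5]].

(** Columns 2, 9 and 17 end the combinable blocks: each may lead to column 0 or restart its own
    block, and column 2 also starts either longer block. The blocks of lengths 4 and 5 only close on
    themselves. *)
Definition column_succ (l : nat) : seq nat :=
  nth [::] [:: [:: 1]; [:: 2]; [:: 0; 3; 10];
               [:: 4]; [:: 5]; [:: 6]; [:: 7]; [:: 8]; [:: 9]; [:: 0; 3];
               [:: 11]; [:: 12]; [:: 13]; [:: 14]; [:: 15]; [:: 16]; [:: 17];
               [:: 0; 10];
               [:: 19]; [:: 20]; [:: 21]; [:: 18];
               [:: 23]; [:: 24]; [:: 25]; [:: 26]; [:: 22]] l.

Definition column_rel : rel nat := fun l l' => l' \in column_succ l.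

Definition hcolor (l y : nat) : nat := nth 0 (nth [::] column_table l) y.
Definition vcolor (l y : nat) : nat := nth 0 (nth [::] column_table l) (6 + y).

Lemma column_table_lt6 l y : nth 0 (nth [::] column_table l) y < 6.
Proof.
have /allP T6 : all (all (gtn 6)) column_table by [].
have [l_lt|l_ge] := ltnP l (size column_table); last first.
  by rewrite (nth_default [::]) // nth_nil.
have /allP C6 := T6 _ (mem_nth [::] l_lt).
have [y_lt|y_ge] := ltnP y (size (nth [::] column_table l)).
  exact: C6 (mem_nth 0 y_lt).
by rewrite nth_default.
Qed.

Definition strip_color (L : nat -> nat) (p q : nat * nat) : nat :=
  if p.1 == q.1 then vcolor (L p.1) (minn p.2 q.2)
  else hcolor (L (minn p.1 q.1)) p.2.

(** The predecessor truncates at column 0, which is harmless because only columns 1 to 3 of a window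
    are expanded. *)
Definition strip_nbrs (p : nat * nat) : seq (nat * nat) :=
  [:: (p.1.+1, p.2), (p.1.-1, p.2) &
      (if 0 < p.2 then [:: (p.1, p.2.-1)] else [::]) ++
      (if p.2 < 5 then [:: (p.1, p.2.+1)] else [::])].

(* Only the walks whose middle vertex lies in the central column 2. *)
Definition window_ok (L : seq nat) : bool :=
  let col := strip_color (nth 0 L) in
  all (fun y => let c := (2, y) in
    all (fun b => all (fun d => (b != d) ==>
      ((col c b != col c d) &&
       all (fun a => all (fun e => (a != c) && (e != c) ==>
         ~~ ((col b a == col c d) && (col c b == col d e)))
       (strip_nbrs d)) (strip_nbrs b)))
    (strip_nbrs c)) (strip_nbrs c)) (iota 0 6).

Lemma column_windows_ok (a b c d e : nat) :
  column_rel a b -> column_rel b c -> column_rel c d -> column_rel d e ->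
  window_ok [:: a; b; c; d; e].
Proof.
(* A label outside the table has no successor, so [a] is one of 27 labels and the check is
   finite. *)
move=> ab bc cd de; have a27 : a \in iota 0 27.
  rewrite mem_iota; case: (ltnP a 27) => // a27.
  by move: ab; rewrite /column_rel /column_succ nth_default.
have H : all (fun a => all (fun b => all (fun c => all (fun d => all (fun e =>
    window_ok [:: a; b; c; d; e])
  (column_succ d)) (column_succ c)) (column_succ b)) (column_succ a)) (iota 0 27).
  by vm_compute.
by have /allP/(_ b ab)/allP/(_ c bc)/allP/(_ d cd)/allP/(_ e de) := allP H a a27.
Qed.

Lemma cycle_nth (T : Type) (x0 : T) (e : rel T) (s : seq T) i :
  cycle e s -> i < size s -> e (nth x0 s i) (nth x0 s (i.+1 %% size s)).
Proof.
case: s => //= x p /(pathP x0) xp; rewrite ltnS => i_le.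
have := xp i; rewrite size_rcons ltnS => /(_ i_le); rewrite -rcons_cons nth_rcons /=.
rewrite ltnS i_le nth_rcons; case: ltngtP i_le => // [i_lt _|-> _].
  by rewrite modn_small.
by rewrite modnn.
Qed.

(** * Lifting walks on the cycle to five-column windows of the line *)

Section ColumnColoring.
Variables (m : nat) (s : seq nat).
Hypotheses (m_ge3 : 3 <= m) (size_s : size s = m) (s_cycle : cycle column_rel s).

Let G := cartesian_product (cycle_graph m) (path_graph 6).

Definition column_coloring (u v : G) : nat :=
  if u.1 == v.1 then vcolor (nth 0 s u.1) (minn u.2 v.2)
  else if v.1 == u.1.+1 %% m :> nat then hcolor (nth 0 s u.1) u.2
  else hcolor (nth 0 s v.1) u.2.

(** Two steps forward do not return to the start, as [m] is at least 3; so each horizontal edge has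
    a well-defined direction. *)
Lemma cycle_succ_asym (i j : 'I_m) : j = i.+1 %% m :> nat -> i != j.+1 %% m :> nat.
Proof.
move=> ->; apply/eqP => /eqP; rewrite -{1}(modn_small (ltn_ord i)).
rewrite -[(i.+1 %% m).+1]addn1 modnDml addn1 -[i.+2]addn2 -{1}[i : nat]addn0.
by rewrite eqn_modDl mod0n modn_small.
Qed.

Lemma column_coloringC (u v : G) :
  adj u v -> column_coloring u v = column_coloring v u.
Proof.
rewrite /adj /= /cart_adj /column_coloring [v.1 == _]eq_sym minnC.
case: (u.1 =P v.1) => [-> //|_] /=; rewrite orbF => /andP[/andP[_ uv] /eqP->].
by case/orP: uv => /eqP uv; rewrite (negPf (cycle_succ_asym uv)) uv eqxx.
Qed.

Variable c : G.

(** This is the column of [c] minus 2 modulo [m], written so that no truncation occurs. For [m]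
    below 5 the window meets some column twice, hence the use of lifts. *)
Let base := c.1 + (m - 2).
Let label (x : nat) := nth 0 s ((base + x) %% m).
Let window := mkseq label 5.

(* [p] is a point of the five-column window centered at the column of [c], and [u]
   is its image under the covering of the cycle by the line. *)
Definition lifts (p : nat * nat) (u : G) : Prop :=
  u.1 = (base + p.1) %% m :> nat /\ u.2 = p.2 :> nat.

Lemma lifts_center : lifts (2, c.2 : nat) c.
Proof.
split=> //=; rewrite /base -addnA subnK ?(leq_trans _ m_ge3) //.
by rewrite modnDr modn_small.
Qed.

Lemma lifts_neq p q u v : lifts p u -> lifts q v -> u != v -> p != q.
Proof.
move=> [u1 u2] [v1 v2]; apply: contra_neq => pq; rewrite -pq in v1 v2.
rewrite (surjective_pairing u) (surjective_pairing v).
by congr pair; apply: val_inj; rewrite /= ?u1 ?u2.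
Qed.

Lemma window_column_ok : window_ok window.
Proof.
have rel x : column_rel (label x) (label x.+1).
  have := @cycle_nth _ 0 _ _ ((base + x) %% m) s_cycle.
  rewrite size_s ltn_mod (leq_trans _ m_ge3) // => /(_ isT).
  by rewrite -[(_ %% m).+1]addn1 modnDml addn1 -addnS.
by apply: column_windows_ok; apply: rel.
Qed.

(** Walk lifting along the covering; the bounds on [p.1] keep the next point inside the window. *)
Lemma lifts_step p u v :
  0 < p.1 < 4 -> lifts p u -> adj u v ->
  exists q, [/\ q \in strip_nbrs p, lifts q v
               & column_coloring u v = strip_color (nth 0 window) p q].
Proof.
move=> /andP[p_gt0 p_lt4] [u1 u2]; have m_gt0 : 0 < m by apply: leq_trans m_ge3.
have labelE x : x < 4 -> nth 0 window x = nth 0 s ((base + x) %% m).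
  by move=> x4; rewrite nth_mkseq // ltnW.
rewrite /adj /= /cart_adj /column_coloring /strip_color.
case/orP => [/andP[/andP[uv /orP[]/eqP uv1] /eqP uv2] |
  /andP[/eqP uv1 /orP[]/eqP uv2]].
- exists (p.1.+1, p.2); rewrite /= (negPf uv) uv1 eqxx; split.
  + by rewrite !inE eqxx.
  + split; last by rewrite -uv2.
    by rewrite uv1 u1 /= addnS -addn1 modnDml addn1.
  + by rewrite (ltn_eqF (ltnSn _)) (minn_idPl (leqnSn _)) labelE // u1 u2.
- exists (p.1.-1, p.2); rewrite /= (negPf uv) (negPf (cycle_succ_asym uv1)).
  have v1 : v.1 = (base + p.1.-1) %% m :> nat.
    rewrite -(modn_small (ltn_ord v.1)); apply/eqP; rewrite -(eqn_modDr 1).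
    by rewrite !addn1 -addnS prednK // -u1 uv1.
  split.
  + by rewrite !inE eqxx orbT.
  + by split; rewrite // -uv2.
  + rewrite gtn_eqF ?ltn_predL // (minn_idPr (leq_pred _)) labelE.
      by rewrite v1 u2.
    by apply: leq_ltn_trans p_lt4; apply: leq_pred.
- exists (p.1, p.2.+1); rewrite /= uv1 !eqxx; split.
  + by rewrite !inE !mem_cat -u2; have := ltn_ord v.2; rewrite uv2 ltnS => ->;
      rewrite !inE eqxx !orbT.
  + by split; rewrite /= -?uv1 // uv2 u2.
  + by rewrite labelE // -uv1 u1 uv2 u2.
- exists (p.1, p.2.-1); rewrite /= uv1 !eqxx; split.
  + by rewrite !inE !mem_cat -u2 uv2 /= !inE eqxx !orbT.
  + by split; rewrite /= -?uv1 // -u2 uv2.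
  + by rewrite labelE // -uv1 u1 -u2 uv2.
Qed.

End ColumnColoring.

Lemma strip_nbrs_near_center y p : p \in strip_nbrs (2, y) -> 0 < p.1 < 4.
Proof.
rewrite !inE mem_cat => /or4P[/eqP->|/eqP->||] //;
  by case: ifP => // _; rewrite inE => /eqP->.
Qed.

Lemma column_star_walk_coloring m s :
  3 <= m -> size s = m -> cycle column_rel s ->
  star_walk_coloring 6 (@column_coloring m s).
Proof.
move=> m_ge3 size_s s_cycle; have colC := @column_coloringC m s m_ge3.
pose step := @lifts_step m s m_ge3.
split=> //.
- move=> u v _; rewrite /column_coloring.
  by case: ifP => _; last case: ifP => _; apply: column_table_lt6.
- move=> u c v uc cv uv; rewrite colC //; rewrite adj_sym in uc.
  have /allP/(_ (c.2 : nat)) := window_column_ok m_ge3 size_s s_cycle c.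
  have c0 := @lifts_center m m_ge3 c.
  have [p [p_nbr pu ->]] := step c (2, c.2 : nat) _ _ isT c0 uc.
  have [q [q_nbr qv ->]] := step c (2, c.2 : nat) _ _ isT c0 cv.
  rewrite mem_iota ltn_ord => /(_ isT)/allP/(_ _ p_nbr)/allP/(_ _ q_nbr)/implyP.
  by move/(_ (lifts_neq pu qv uv))/andP => [].
(* The walk is lifted from its middle vertex [c] outwards in both directions, so its first two edges
   are reversed. *)
move=> a b c d e ab bc cd de ac bd ce; rewrite (colC a b) // (colC b c) //.
rewrite adj_sym in ab; rewrite adj_sym in bc.
have /allP/(_ (c.2 : nat)) := window_column_ok m_ge3 size_s s_cycle c.
have c0 := @lifts_center m m_ge3 c.
have [p [p_nbr pb ->]] := step c (2, c.2 : nat) _ _ isT c0 bc.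
have [q [q_nbr qd ->]] := step c (2, c.2 : nat) _ _ isT c0 cd.
have [p' [p'_nbr pa ->]] := step c _ _ _ (strip_nbrs_near_center p_nbr) pb ab.
have [q' [q'_nbr qe ->]] := step c _ _ _ (strip_nbrs_near_center q_nbr) qd de.
rewrite mem_iota ltn_ord => /(_ isT)/allP/(_ _ p_nbr)/allP/(_ _ q_nbr)/implyP.
move/(_ (lifts_neq pb qd bd))/andP => [_ /allP/(_ _ p'_nbr)/allP/(_ _ q'_nbr)].
rewrite (lifts_neq pa c0 ac) (lifts_neq qe c0) //; last by rewrite eq_sym.
Qed.

(** * Closed column sequences of every length at least 3 *)

Definition repeat012 (a : nat) : seq nat := flatten (nseq a [:: 0; 1; 2]).

Lemma size_repeat012 a : size (repeat012 a) = 3 * a.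
Proof. by elim: a => // a IHa; rewrite /= -/(repeat012 a) IHa mulnS. Qed.

Lemma path_repeat012 x a : column_rel x 0 -> path column_rel x (repeat012 a).
Proof. by elim: a x => //= a IHa x ->; apply: IHa. Qed.

Lemma last_repeat012 x a : last x (repeat012 a) = if a is 0 then x else 2.
Proof. by case: a => // a; rewrite /=; elim: a. Qed.

(** If [a = 0], the block closes on itself; otherwise it continues with 0, and the final 2 leads
    back to [x]. *)
Lemma cycle_cat_repeat012 x p a :
  column_rel (last x p) 0 -> column_rel (last x p) x -> column_rel 2 x ->
  path column_rel x p -> cycle column_rel (x :: p ++ repeat012 a).
Proof.
move=> px0 pxx x2 xp; rewrite (cycle_path 0) /= cat_path xp path_repeat012 // !andbT.
by rewrite last_cat last_repeat012; case: a.
Qed.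

Lemma column_cycle_exists m :
  3 <= m -> exists2 s, size s = m & cycle column_rel s.
Proof.
move=> m3.
have rep x p a : column_rel (last x p) 0 -> column_rel (last x p) x ->
    column_rel 2 x -> path column_rel x p -> m = (size p).+1 + 3 * a ->
    exists2 s, size s = m & cycle column_rel s.
  move=> *; exists (x :: p ++ repeat012 a); last exact: cycle_cat_repeat012.
  by rewrite /= size_cat size_repeat012.
have mE := divn_eq m 3; have : m %% 3 < 3 by rewrite ltn_mod.
(* The residue of [m] modulo 3 selects a block of 3, 7 or 8 columns, padded by copies of [0, 1, 2];
   only 4 and 5 are too short for their block. *)
case: (m %% 3) mE => [|[|[|//]]] mE _; case: (m %/ 3) mE => [|[|q]] mE;
  try by rewrite mE in m3.
- by exists [:: 0; 1; 2]; rewrite ?mE.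
- by apply: (rep 0 [:: 1; 2] q.+1) => //; rewrite mE addn0 mulnC mulnS.
- by exists (iota 18 4); rewrite ?mE.
- by apply: (rep 3 (iota 4 6) q) => //; rewrite mE mulnC !mulnS addn1.
- by exists (iota 22 5); rewrite ?mE.
- by apply: (rep 10 (iota 11 7) q) => //; rewrite mE mulnC !mulnS addn2.
Qed.

Lemma cycle_path6_star_edge_colorable m : 3 <= m ->
  star_edge_colorable (cartesian_product (cycle_graph m) (path_graph 6)) 6.
Proof.
move=> m_ge3; have [s size_s s_cycle] := column_cycle_exists m_ge3.
apply/star_edge_colorableP; exists (column_coloring s).
exact: column_star_walk_coloring.
Qed.

(** * Homomorphisms into products of a cycle and a path *)

Lemma modn_inj_near (m x y : nat) :
  x <= y < x + m -> x = y %[mod m] -> x = y.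
Proof.
case/andP=> xy ym /eqP; rewrite eq_sym eqn_mod_dvd // => m_dvd.
apply/eqP; rewrite eqn_leq xy -subn_eq0 /=; apply: contraTT m_dvd.
by rewrite -lt0n => yx; rewrite gtnNdvd // ltn_subLR.
Qed.

(** Neighbors of a common vertex have first coordinates at most 2 apart, and [m] is at least 3, so
    reduction modulo [m] is locally injective. *)
Lemma path_star_edge_colorable_of_cycle m n k p q :
  3 <= m -> p <= n ->
  star_edge_colorable (cartesian_product (cycle_graph m) (path_graph n)) k ->
  star_edge_colorable (cartesian_product (path_graph q) (path_graph p)) k.
Proof.
move=> m_ge3 pn; have m_gt0 : 0 < m by apply: leq_trans m_ge3.
pose f (u : cartesian_product (path_graph q) (path_graph p)) :
    cartesian_product (cycle_graph m) (path_graph n) :=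
  (Ordinal (ltn_pmod u.1 m_gt0), widen_ord pn u.2).
have succ_adj (x y : 'I_q) : y = x.+1 :> nat ->
    @cycle_adj m (Ordinal (ltn_pmod x m_gt0)) (Ordinal (ltn_pmod y m_gt0)).
  move=> xy; apply/andP; split; last first.
    by rewrite /= xy -[(x %% m).+1]addn1 modnDml addn1 eqxx.
  rewrite -val_eqE /= xy; apply/eqP => /modn_inj_near/eqP.
  rewrite leqnSn -addn1 ltn_add2l (leq_trans _ m_ge3) // -addn1.
  by rewrite -{1}[x : nat]addn0 eqn_add2l => /(_ isT).
have near (u v w : cartesian_product (path_graph q) (path_graph p)) :
    adj u v -> adj v w -> u.1 <= w.1 -> w.1 < u.1 + m.
  move=> uv vw _.
  have le1 (x y : cartesian_product (path_graph q) (path_graph p)) :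
      adj x y -> y.1 <= x.1.+1.
    case/orP => /andP[]; first by case/orP => /eqP-> // _; rewrite -ltnS ltnW.
    by move/eqP->.
  apply: leq_ltn_trans (le1 _ _ vw) _; apply: leq_trans (_ : u.1 + 3 <= _).
    by rewrite addn3 !ltnS le1.
  by rewrite leq_add2l.
apply: (star_edge_colorable_hom (f := f)) => [u v | u v w uv vw].
  case/orP => /andP[uv1 uv2]; apply/orP; [left | right]; apply/andP; split.
  - by case/orP: uv1 => /eqP/succ_adj //; rewrite /= cycle_adj_sym.
  - by rewrite /f /= (eqP uv2).
  - by rewrite /f /= (eqP uv1).
  - exact: uv2.
apply: contra_neq => -[uw1 uw2].
rewrite (surjective_pairing u) (surjective_pairing w).
congr pair; apply: val_inj => //=.
have [le|lt] := leqP u.1 w.1.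
  by apply: modn_inj_near uw1; rewrite le (near u v w).
apply/esym; apply: modn_inj_near (esym uw1).
by rewrite ltnW // (near w v u) // 1?adj_sym // ltnW.
Qed.

Lemma cycle_path_star_edge_colorable_leq m n n' k :
  n <= n' ->
  star_edge_colorable (cartesian_product (cycle_graph m) (path_graph n')) k ->
  star_edge_colorable (cartesian_product (cycle_graph m) (path_graph n)) k.
Proof.
move=> nn'; pose f (u : cartesian_product (cycle_graph m) (path_graph n)) :
  cartesian_product (cycle_graph m) (path_graph n') := (u.1, widen_ord nn' u.2).
apply: (star_edge_colorable_hom (f := f)) => [//|u v w _ _].
apply: contra_neq => -[uw1 uw2].
rewrite (surjective_pairing u) (surjective_pairing w).
by congr pair => //; apply: val_inj.
Qed.

Theorem theorem26 (m n : nat) (hm : 3 <= m) (hn : n \in [:: 3; 4; 5; 6]) :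
  star_chromatic_index (cartesian_product (cycle_graph m) (path_graph n)) = 6.
Proof.
have /andP[n_ge3 n_le6] : 3 <= n <= 6 by move: hn; rewrite !inE => /or4P[]/eqP->.
apply: star_chromatic_index_eq.
  apply: cycle_path_star_edge_colorable_leq n_le6 _.
  exact: cycle_path6_star_edge_colorable.
apply: contra grid53_not_star_edge_colorable.
exact: path_star_edge_colorable_of_cycle.
Qed.
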